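(* Let $\lambda>\sqrt{2+\sqrt5}$, let $\Delta=\begin{pmatrix} 0 & G \\ G^t & 0 \end{pmatrix}$ be the adjacency matrix of a bipartition of the graph $\Gamma_\lambda$, and let $p$ be a polynomial of degree $n\ge1$ whose exponents are either all even or all odd and such that $p(\Delta)$ is the adjacency matrix of a bipartite graph, so that $p(\Delta)=\begin{pmatrix} H & 0 \\ 0 & K \end{pmatrix}$ if the exponents are even and $p(\Delta)=\begin{pmatrix} 0 & H \\ K & 0 \end{pmatrix}$ if they are odd. Suppose that there exists a commuting square of infinite dimensional multi-matrix algebras of the form $$\begin{array}{ccc} C&\subset_K&D\\ \cup_G&&\cup_G\\ A&\subset_H&B\end{array}\ \text{ if $n$ is even,}\qquad \begin{array}{ccc} C&\subset_K&D\\ \cup_G&&\cup_{G^t}\\ A&\subset_H&B\end{array}\ \text{ if $n$ is odd,}$$ with respect to the trace whose weights are given by the Perron–Frobenius vector $\xi$ of $\Gamma_\lambda$. Then $\Gamma_\lambda$ is eventually periodic: there exists $J$ such that $n_i=n_{i+n}$ for all $i\ge J$.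
   Context: For $\lambda>\sqrt{2+\sqrt5}$ choose $x>0$ with $\lambda=e^x+e^{-x}$. Numbers $n_k,r_k,a_k$ are defined inductively by $n_0=0$, $r_1=\lambda$, $a_0=1$ and, for $k\ge1$, $$n_k=\max\Big\{j\in\mathbb Z:\lambda-\frac1{r_k}-\frac j\lambda\ge e^{-x}\Big\},\qquad r_{k+1}=\lambda-\frac1{r_k}-\frac{n_k}\lambda,\qquad a_k=r_ka_{k-1}.$$ The infinite graph $\Gamma_\lambda$ consists of the one-sided infinite path with vertices $P_0,P_1,P_2,\dots$ ($P_i$ joined to $P_{i+1}$) together with $n_k$ leaves $Q_{k,1},\dots,Q_{k,n_k}$ attached to $P_k$ for each $k$. Its Perron–Frobenius vector (largest eigenvalue $\lambda$) is $\xi(P_k)=a_k$, $\xi(Q_{k,j})=a_k/\lambda$. An infinite dimensional multi-matrix algebra is a countable direct sum of full complex matrix algebras; a trace on it is given by its weights on minimal projections of the summands and is assumed finite. $X\subset_MY$ means $X$ is a unital subalgebra of $Y$ with inclusion matrix $M$ ($M_{ij}$ is the multiplicity of the $i$-th summand of $X$ in the $j$-th summand of $Y$). The diagrams mean $A\subset_HB$, $A\subset_GC$, $C\subset_KD$ and $B\subset_GD$ (respectively $B\subset_{G^t}D$). Such a square with a trace on $D$ is a commuting square if the trace-preserving conditional expectations satisfy $E_A=E_BE_C=E_CE_B$. The trace weights on $D$ are (up to scaling) the coordinates of $\xi$ on the part of the bipartition labeling the summands of $D$. *)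

(* Defs.v *)
From HB Require Import structures.
From mathcomp Require Import all_boot all_order all_algebra.
From mathcomp Require Import finmap.
From mathcomp Require Import all_classical all_reals all_analysis.
From mathcomp Require Import showcase.summability.
From mathcomp Require Export complex.

Set Implicit Arguments.
Unset Strict Implicit.
Unset Printing Implicit Defensive.

Import Order.TTheory GRing.Theory Num.Theory.
Import numFieldNormedType.Exports.

Local Open Scope classical_set_scope.
Local Open Scope sesquilinear_scope.
Local Open Scope complex_scope.
Local Open Scope ring_scope.

(** * The graph Gamma_lambda *)

Definition is_max_int (S : set int) (m : int) : Prop :=
  S m /\ forall j : int, S j -> j <= m.

(** The value [r 0] plays no role.  The maximum is taken over all integers; it
    is nonnegative because [expR (- x) <= r k], so [n] can take values in
    [nat]. *)
Record gamma_sequences (R : realType) (lam x : R)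
    (n : nat -> nat) (r a : nat -> R) : Prop := GammaSequences {
  gamma_n0 : n 0%N = 0%N ;
  gamma_r1 : r 1%N = lam ;
  gamma_a0 : a 0%N = 1 ;
  gamma_n : forall k : nat, (0 < k)%N ->
    is_max_int [set j : int | expR (- x) <= lam - (r k)^-1 - j%:~R / lam]
               (n k)%:Z ;
  gamma_r : forall k : nat, (0 < k)%N ->
    r k.+1 = lam - (r k)^-1 - (n k)%:R / lam ;
  gamma_a : forall k : nat, (0 < k)%N -> a k = r k * a k.-1
}.

(** [inl k] is P_k, and [inr (existT _ k j)] is the leaf Q_{k,j+1} at P_k. *)
Definition gamma_vertex (n : nat -> nat) := (nat + {k : nat & 'I_(n k)})%type.

Definition gamma_adj (n : nat -> nat) (u v : gamma_vertex n) : bool :=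
  match u, v with
  | inl i, inl j => (j == i.+1) || (i == j.+1)
  | inl i, inr q => tag q == i
  | inr q, inl i => tag q == i
  | inr _, inr _ => false
  end.

Definition gamma_matrix (n : nat -> nat) (u v : gamma_vertex n) : nat :=
  gamma_adj u v.

Definition gamma_weight (R : realType) (lam : R) (n : nat -> nat)
    (a : nat -> R) (v : gamma_vertex n) : R :=
  match v with
  | inl k => a k
  | inr q => a (tag q) / lam
  end.

Definition is_bipartition (n : nat -> nat) (col : gamma_vertex n -> bool) :
  Prop := forall u v, gamma_adj u v -> col u != col v.

Definition class (n : nat -> nat) (col : gamma_vertex n -> bool) (b : bool) :=
  {v : gamma_vertex n | col v == b}.

(** * Matrices over infinite index sets *)

Definition trmat (I J : Type) (M : I -> J -> nat) : J -> I -> nat :=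
  fun j i => M i j.

Definition block (n : nat -> nat) (col : gamma_vertex n -> bool)
    (M : gamma_vertex n -> gamma_vertex n -> nat) (b c : bool) :
    class col b -> class col c -> nat :=
  fun u v => M (val u) (val v).

Arguments block {n} col M b c.

Section MatrixPolynomial.
Variables (V : choiceType) (C : comNzRingType).

(** The sum is finitely supported when the rows of [A] are, which is the only
    case in which this is used. *)
Definition inf_mul (A B : V -> V -> C) : V -> V -> C :=
  fun u v => \sum_(w \in [set: V]) A u w * B w v.

Definition inf_one : V -> V -> C := fun u v => (u == v)%:R.

Definition inf_pow (A : V -> V -> C) (k : nat) : V -> V -> C :=
  iter k (inf_mul A) inf_one.

Definition inf_horner (p : {poly C}) (A : V -> V -> C) : V -> V -> C :=
  fun u v => \sum_(k < size p) p`_k * inf_pow A k u v.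

End MatrixPolynomial.

(** * Infinite dimensional multi-matrix algebras

    The direct sum of the full matrix algebras of sizes [d i] is the algebra of
    bounded families (the l^infinity direct sum): it is unital, and a trace
    with summable weights is defined on all of it. *)

Section MultiMatrix.
Variable R : realType.
Local Notation C := R[i].

Definition family (I : Type) (d : I -> nat) := forall i : I, 'M[C]_(d i).

Section Algebra.
Variables (I : countType) (d : I -> nat).
Implicit Types x y : family d.

Definition sqnorm (m : nat) (v : 'cV[C]_m) : C := \sum_k `|v k 0| ^+ 2.

(** [M] bounds the squares of the operator norms of the components. *)
Definition mma : set (family d) :=
  [set x | exists M : C,
     forall (i : I) (v : 'cV[C]_(d i)), sqnorm (x i *m v) <= M * sqnorm v].

Definition mma_one : family d := fun i => 1%:M.
Definition mma_add x y : family d := fun i => x i + y i.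
Definition mma_scale (c : C) x : family d := fun i => c *: x i.
Definition mma_mul x y : family d := fun i => x i *m y i.
Definition mma_adj x : family d := fun i => (x i)^t*.

(** The element with component [m] in the [i]-th summand and 0 elsewhere. *)
Definition summand (i : I) (m : 'M[C]_(d i)) : family d :=
  eqtype.dfwith (fun j => 0 : 'M[C]_(d j)) m.

(** A trace is given by its weight [t i] on the minimal projections of the
    [i]-th summand. *)
Definition mma_trace (t : I -> R) x : C :=
  summability.sum (fun i => (t i)%:C * \tr (x i) : C^o).

(** The value of the trace at 1 is finite. *)
Definition finite_trace (t : I -> R) : Prop :=
  (\esum_(i in [set: I]) (t i * (d i)%:R)%:E < +oo)%E.

(** [E] is a conditional expectation of [mma] onto the subalgebra [N]
    preserving the trace with weights [t]. *)
Record trace_cond_exp (t : I -> R) (N : set (family d))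
    (E : family d -> family d) : Prop := TraceCondExp {
  cond_exp_range : forall x, mma x -> N (E x) ;
  cond_exp_id : forall x, N x -> E x = x ;
  cond_exp_add : forall x y, mma x -> mma y ->
    E (mma_add x y) = mma_add (E x) (E y) ;
  cond_exp_scale : forall c x, mma x -> E (mma_scale c x) = mma_scale c (E x) ;
  cond_exp_bimodule : forall x y z, N x -> mma y -> N z ->
    E (mma_mul (mma_mul x y) z) = mma_mul (mma_mul x (E y)) z ;
  cond_exp_positive : forall x, mma x ->
    exists2 y, mma y & E (mma_mul (mma_adj x) x) = mma_mul (mma_adj y) y ;
  cond_exp_trace : forall x, mma x -> mma_trace t (E x) = mma_trace t x
}.

End Algebra.

Definition minimal_projection (m : nat) (q : 'M[C]_m) : Prop :=
  [/\ q *m q = q, q^t* = q & \rank q = 1%N].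

(** [f] realizes the direct sum with sizes [dX] as a unital *-subalgebra of the
    direct sum with sizes [dY], with inclusion matrix [M]: the [i]-th summand
    of the source has multiplicity [M i j] in the [j]-th summand of the target,
    which is the rank of the [j]-th component of the image of a minimal
    projection of that summand.  Normality says that the representation on the
    [j]-th summand is the sum of its restrictions to the summands of the source
    (only finitely many of which are nonzero); for finite direct sums it follows
    from additivity, and here it says that traces given by weights restrict to
    traces given by weights. *)
Record mma_inclusion (I J : countType) (dX : I -> nat) (dY : J -> nat)
    (M : I -> J -> nat) (f : family dX -> family dY) : Prop := MmaInclusion {
  incl_range : forall x, mma x -> mma (f x) ;
  incl_inj : forall x y, mma x -> mma y -> f x = f y -> x = y ;
  incl_add : forall x y, mma x -> mma y ->
    f (mma_add x y) = mma_add (f x) (f y) ;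
  incl_scale : forall c x, mma x -> f (mma_scale c x) = mma_scale c (f x) ;
  incl_mul : forall x y, mma x -> mma y ->
    f (mma_mul x y) = mma_mul (f x) (f y) ;
  incl_adj : forall x, mma x -> f (mma_adj x) = mma_adj (f x) ;
  incl_one : f (@mma_one I dX) = @mma_one J dY ;
  incl_normal : forall x j, mma x ->
    f x j = \sum_(i \in [set: I]) f (summand (x i)) j ;
  incl_multiplicity : forall (i : I) (j : J) (q : 'M[C]_(dX i)),
    minimal_projection q -> \rank (f (summand q) j) = M i j
}.

(** The square
<<
      C  c_K   D
      U_G1     U_G2
      A  c_H   B
>>
    in which A, B, C are seen as subalgebras of D through the inclusions, with
    the trace of weights [t] on D. *)
Definition exists_commuting_square (IA IB IC ID : countType)
    (H : IA -> IB -> nat) (G1 : IA -> IC -> nat)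
    (K : IC -> ID -> nat) (G2 : IB -> ID -> nat) (t : ID -> R) : Prop :=
  exists (dA : IA -> nat) (dB : IB -> nat) (dC : IC -> nat) (dD : ID -> nat)
    (fAB : family dA -> family dB) (fAC : family dA -> family dC)
    (fCD : family dC -> family dD) (fBD : family dB -> family dD)
    (EA EB EC : family dD -> family dD),
    [/\ [/\ forall i, (0 < dA i)%N, forall i, (0 < dB i)%N,
            forall i, (0 < dC i)%N & forall i, (0 < dD i)%N],
        [/\ mma_inclusion H fAB, mma_inclusion G1 fAC,
            mma_inclusion K fCD & mma_inclusion G2 fBD],
        (forall x, mma x -> fBD (fAB x) = fCD (fAC x)) /\
        @finite_trace ID dD t,
        [/\ trace_cond_exp t [set fBD (fAB x) | x in @mma IA dA] EA,
            trace_cond_exp t [set fBD x | x in @mma IB dB] EB &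
            trace_cond_exp t [set fCD x | x in @mma IC dC] EC] &
        forall x, mma x -> EA x = EB (EC x) /\ EA x = EC (EB x)].

End MultiMatrix.

(* Main.v *)
Require Import Defs.
From HB Require Import structures.
From mathcomp Require Import all_boot all_order all_algebra.
From mathcomp Require Import finmap.
From mathcomp Require Import all_classical all_reals all_analysis.
From mathcomp Require Import showcase.summability.
From mathcomp Require Import ring lra zify.

Set Implicit Arguments.
Unset Strict Implicit.
Unset Printing Implicit Defensive.

Import Order.TTheory GRing.Theory Num.Theory.
Import numFieldNormedType.Exports.

Local Open Scope classical_set_scope.
Local Open Scope sesquilinear_scope.
Local Open Scope complex_scope.
Local Open Scope ring_scope.

(** Let [A], [B], [C], [D] be a commuting square, [q] a minimal projection of a
    summand [u] of [A], [pb] the component of [q] in a summand [w] of [B] and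
    [pc] its component in a summand [v] of [C].  Since [E_B E_C = E_A] and
    [E_A pc] is a multiple of [q], the trace satisfies
    [tau (pb pc) tau q = tau pb tau pc].  In a summand [d] of [D] that can be
    reached from [u] only through [w] and only through [v], both [pb] and [pc]
    coincide with [q].  As the other summands contribute nonnegatively to
    [tau (pb pc)], this bounds the total weight of all such [d]
    ([commuting_square_inequality]).

    The weights of the traces on [A], [B], [C] are multiples of the
    Perron-Frobenius vector, because it is an eigenvector of [Delta] and of
    [p(Delta)] ([gamma_weight_eigen], [W_eigen]), so they cancel and leave
    [(\sum_d xi d) * xi u <= xi w * xi v] ([gamma_inequality]).

    In the graph, [p(Delta)] connects only vertices at distance at most [deg],
    and it does connect [P_i] with [P_(i+deg)].  Take [u = P_i],
    [v = P_(i+1)], [w = P_(i+deg)] and let [d] range over [P_(i+deg+1)] and the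
    leaves at [P_(i+deg)] ([gamma_ascending]), or take the mirror image of this
    configuration ([gamma_descending]).  In terms of the ratios [r] both give
    [r (j+deg+1) + n (j+deg) / lam <= r (j+1)], for [j >= 1] such that
    [P_j] or [P_(j+deg)] has the colour of the summands of [A].  From index 2
    on, the values of [r] lie in a half-open interval of length [1 / lam], so
    [n (j+deg) = 0] for these [j], and [r (j+deg+1) <= r (j+1)].  Together these
    give [r (k+deg) <= r k] for all large [k], so [r] converges along each
    residue class modulo [deg]; the integers [n], which are a continuous
    function of two consecutive values of [r], are then eventually periodic
    ([eventually_periodic]). *)

(** * Sums with finite support *)

Lemma big_supp_eq (V : nmodType) (T : eqType) (s t : seq T) (F : T -> V) :
    uniq s -> uniq t -> (forall i, i \notin s -> F i = 0) ->
    (forall i, i \notin t -> F i = 0) ->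
  \sum_(i <- s) F i = \sum_(i <- t) F i.
Proof.
have aux (s' t' : seq T) : (forall i, i \notin t' -> F i = 0) ->
    \sum_(i <- s') F i = \sum_(i <- [seq j <- s' | j \in t']) F i.
  move=> h; rewrite big_filter [LHS](bigID [in t']) /= [X in _ + X]big1 ?addr0//.
move=> us ut hs ht; rewrite (aux _ _ ht) (aux t s hs); apply: perm_big.
apply: uniq_perm; rewrite ?filter_uniq// => i.
by rewrite !mem_filter andbC.
Qed.

Lemma fsbig_supp_seq (V : nmodType) (T : choiceType) (s : seq T) (F : T -> V) :
  uniq s -> (forall i, i \notin s -> F i = 0) ->
  \sum_(i \in [set: T]) F i = \sum_(i <- s) F i.
Proof.
move=> us hs; rewrite (fsbigE s)//; last by move=> i _; exact: hs.
by apply: eq_bigl => i; rewrite in_setT.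
Qed.

Lemma summability_sum_supp (T : choiceType) (K : numFieldType)
    (V : normedModType K) (s : seq T) (F : T -> V) :
  uniq s -> (forall i, i \notin s -> F i = 0) ->
  summability.sum F = \sum_(i <- s) F i.
Proof.
move=> us hs; apply: (@norm_lim_near_cst K V _ _ totally_filter).
exists [fset x | x in s]%fset => //= A /= sA.
rewrite /partial_sum -(big_seq_fsetE _ A xpredT)/=.
apply: big_supp_eq => // i; apply: contraNeq => Fi0.
by apply: (fsubsetP sA); rewrite inE; apply: contraNT Fi0 => /hs ->.
Qed.

(** * Projections and traces in a full matrix algebra *)

Lemma mxtrace_idempotent (F : fieldType) (m : nat) (q : 'M[F]_m) :
  q *m q = q -> \tr q = (\rank q)%:R.
Proof.
move=> qq; rewrite -{1}(mulmx_base q) mxtrace_mulC.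
suff -> : row_base q *m col_base q = 1%:M by rewrite mxtrace1.
have fullc := col_base_full q; have freer := row_base_free q.
apply: (row_full_inj fullc); apply: (row_free_inj freer).
by rewrite mulmx1 mulmxA mulmx_base -mulmxA mulmx_base.
Qed.

(** A linear functional vanishing on commutators is a multiple of the trace. *)
Lemma tracial_mxtrace (F : comNzRingType) (m : nat) (phi : 'M[F]_m -> F)
    (k : 'I_m) :
  (forall A B, phi (A + B) = phi A + phi B) ->
  (forall a A, phi (a *: A) = a * phi A) ->
  (forall A B, phi (A *m B) = phi (B *m A)) ->
  forall A, phi A = phi (delta_mx k k) * \tr A.
Proof.
move=> phiD phiZ phiC A.
have phi0 : phi 0 = 0 by rewrite -(scale0r 0) phiZ mul0r.
have phi_sum := big_morph phi phiD phi0.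
have phi_diag i : phi (delta_mx i i) = phi (delta_mx k k).
  by rewrite -(mul_delta_mx k i i) phiC mul_delta_mx.
rewrite {1}(matrix_sum_delta A) phi_sum [RHS]mulr_sumr; apply: eq_bigr => i _.
rewrite phi_sum (bigD1 i)//= [X in _ + X]big1 => [|j ji].
  by rewrite addr0 phiZ phi_diag mulrC.
rewrite phiZ -(mul_delta_mx i i j) phiC mul_delta_mx_0//.
by rewrite phi0 mulr0.
Qed.

Lemma minimal_projection_delta (R : realType) (m : nat) (k : 'I_m) :
  minimal_projection (delta_mx k k : 'M[R[i]]_m).
Proof.
split; first by rewrite mul_delta_mx.
- by rewrite trmx_delta map_delta_mx.
- exact: mxrank_delta.
Qed.

Lemma mxtrace_adj_mul_eq0 (R : realType) (m : nat) (A : 'M[R[i]]_m) :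
  \tr (A^t* *m A) = 0 -> A = 0.
Proof.
rewrite /mxtrace => h; apply/matrixP => k l; rewrite mxE.
have E j : (A^t* *m A) j j = \sum_i `|A i j| ^+ 2.
  by rewrite mxE; apply: eq_bigr => i _; rewrite !mxE normCK mulrC.
have ge0 j : 0 <= (A^t* *m A) j j.
  by rewrite E; apply: sumr_ge0 => i _; rewrite exprn_ge0.
have /eqP := @psumr_eq0P _ _ xpredT _ (fun j _ => ge0 j) h l isT.
rewrite E => /eqP hl; have norm_ge0 i : 0 <= `|A i l| ^+ 2 by rewrite exprn_ge0.
have /eqP := @psumr_eq0P _ _ xpredT _ (fun i _ => norm_ge0 i) hl k isT.
by rewrite expf_eq0/= normr_eq0 => /eqP.
Qed.

Lemma mxtrace_adj_mul_ge0 (R : realType) (m : nat) (A : 'M[R[i]]_m) :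
  0 <= \tr (A^t* *m A).
Proof.
apply: sumr_ge0 => k _; rewrite mxE; apply: sumr_ge0 => l _.
by rewrite !mxE mulrC -normCK exprn_ge0.
Qed.

Lemma mxtrace_mul_projections_ge0 (R : realType) (m : nat)
    (P Q : 'M[R[i]]_m) :
  P *m P = P -> P^t* = P -> Q *m Q = Q -> Q^t* = Q -> 0 <= \tr (P *m Q).
Proof.
move=> PP Padj QQ Qadj.
have -> : \tr (P *m Q) = \tr ((P *m Q)^t* *m (P *m Q)).
  rewrite trmx_mul map_mxM Padj Qadj mulmxA -(mulmxA Q) PP.
  by rewrite [RHS]mxtrace_mulC mulmxA QQ mxtrace_mulC.
exact: mxtrace_adj_mul_ge0.
Qed.

(** The corner of a full matrix algebra cut by a minimal projection is
    one-dimensional. *)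
Lemma rank1_compression (F : fieldType) (m : nat) (k : 'I_m) (A : 'M[F]_m) :
  delta_mx k k *m A *m delta_mx k k = A k k *: delta_mx k k.
Proof.
apply/matrixP => i j; rewrite !mxE (bigD1 k)//= big1 => [|l lk].
  rewrite addr0 !mxE (bigD1 k)//= big1 => [|l lk].
    by rewrite addr0 !mxE eqxx andbT/=; case: (j == k); case: (i == k) => /=; ring.
  by rewrite mxE (negbTE lk) andbF mul0r.
by rewrite !mxE (negbTE lk) mulr0.
Qed.

(** * Bounded families of matrices *)

Section BoundedFamilies.
Variable R : realType.
Local Notation C := R[i].

Lemma sqnorm_ge0 (m : nat) (v : 'cV[C]_m) : 0 <= sqnorm v.
Proof. by apply: sumr_ge0 => k _; rewrite exprn_ge0. Qed.

(** Every matrix is bounded: with [s] the sum of the moduli of the entries of a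
    row, the square of that row's entry of [A *m v] is at most
    [s ^+ 2 * sqnorm v]. *)
Lemma sqnorm_mulmx_bound (m : nat) (A : 'M[C]_m) (v : 'cV[C]_m) :
  sqnorm (A *m v) <= (\sum_k (\sum_l `|A k l|) ^+ 2) * sqnorm v.
Proof.
have norm2_le l l' : `|v l 0| * `|v l' 0| <= sqnorm v.
  have le_sq j : `|v j 0| ^+ 2 <= sqnorm v.
    by rewrite /sqnorm (bigD1 j)//= lerDl sumr_ge0.
  have [le_ll'|le_l'l] := real_leP (normr_real (v l 0)) (normr_real (v l' 0)).
    by apply: le_trans (le_sq l'); rewrite expr2 ler_wpM2r.
  by apply: le_trans (le_sq l); rewrite expr2 ler_wpM2l// ltW.
rewrite {1}/sqnorm; move: (sqnorm v) norm2_le => N norm2_le.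
rewrite mulr_suml; apply: ler_sum => k _.
apply: (@le_trans _ _ ((\sum_l `|A k l| * `|v l 0|) ^+ 2)).
  rewrite lerXn2r ?nnegrE//; first by rewrite sumr_ge0// => l _; rewrite mulr_ge0.
  rewrite mxE; apply: le_trans (ler_norm_sum _ _ _) _.
  by apply: ler_sum => l _; rewrite normrM.
rewrite !expr2 !mulr_suml; apply: ler_sum => l _.
rewrite !mulr_sumr mulr_suml; apply: ler_sum => l' _.
by rewrite mulrACA ler_wpM2l// mulr_ge0.
Qed.

Section OneFamily.
Variables (I : countType) (d : I -> nat).
Implicit Types x y : Defs.family R d.

(** The components of [x] outside the finite list [s] vanish. *)
Definition supported (s : seq I) x := forall i, i \notin s -> x i = 0.

Lemma mma_supported (s : seq I) x : supported s x -> mma x.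
Proof.
move=> hs; pose B i : C := \sum_k (\sum_l `|x i k l|) ^+ 2.
have B0 i : 0 <= B i.
  by apply: sumr_ge0 => k _; rewrite exprn_ge0// sumr_ge0.
exists (\sum_(i <- s) B i) => i v.
have [si|/hs ->] := boolP (i \in s); last first.
  rewrite mul0mx {1}/sqnorm big1 ?mulr_ge0 ?sqnorm_ge0 ?sumr_ge0// => k _.
  by rewrite mxE normr0 expr0n.
apply: le_trans (sqnorm_mulmx_bound _ _) _.
apply: ler_wpM2r; first exact: sqnorm_ge0.
by rewrite (big_rem i)//= lerDl sumr_ge0.
Qed.

Lemma mma_mul_closed x y : mma x -> mma y -> mma (mma_mul x y).
Proof.
move=> [M1 h1] [M2 h2]; exists (`|M1| * `|M2|) => i v.
have abs_bound (M a b : C) : 0 <= b -> 0 <= a -> a <= M * b -> a <= `|M| * b.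
  move=> b0 a0 h; suff -> : `|M| * b = M * b by [].
  by rewrite -{1}(ger0_norm b0) -normrM ger0_norm// (le_trans a0).
rewrite /mma_mul -mulmxA.
apply: le_trans (abs_bound _ _ _ _ _ (h1 i _)) _; rewrite ?sqnorm_ge0//.
rewrite -mulrA ler_wpM2l//.
exact: abs_bound (sqnorm_ge0 _) (sqnorm_ge0 _) (h2 _ _).
Qed.

Lemma family_ext x y : (forall i, x i = y i) -> x = y.
Proof. by move=> h; apply: functional_extensionality_dep. Qed.

Lemma summand_in i (m : 'M[C]_(d i)) : summand m i = m.
Proof. exact: dfwith_in. Qed.

Lemma summand_out i j (m : 'M[C]_(d i)) : i != j -> summand m j = 0.
Proof. by move=> ij; rewrite /summand dfwith_out. Qed.

Lemma supported_summand i (m : 'M[C]_(d i)) : supported [:: i] (summand m).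
Proof. by move=> j; rewrite inE eq_sym => /summand_out. Qed.

Lemma mma_summand i (m : 'M[C]_(d i)) : mma (summand m).
Proof. exact: mma_supported (supported_summand m). Qed.

Lemma summand_ext i x (m : 'M[C]_(d i)) :
  x i = m -> (forall j, i != j -> x j = 0) -> x = summand m.
Proof.
move=> xi xj; apply: family_ext => j; have [<-|ij] := eqVneq i j.
  by rewrite summand_in.
by rewrite summand_out// xj.
Qed.

Lemma summandD i (m m' : 'M[C]_(d i)) :
  mma_add (summand m) (summand m') = summand (m + m').
Proof.
apply: summand_ext => [|j ij]; rewrite /mma_add ?summand_in//.
by rewrite !summand_out// addr0.
Qed.

Lemma summandZ i (a : C) (m : 'M[C]_(d i)) :
  mma_scale a (summand m) = summand (a *: m).
Proof.
apply: summand_ext => [|j ij]; rewrite /mma_scale ?summand_in//.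
by rewrite summand_out// scaler0.
Qed.

Lemma mul_summand i (m m' : 'M[C]_(d i)) :
  mma_mul (summand m) (summand m') = summand (m *m m').
Proof.
apply: summand_ext => [|j ij]; rewrite /mma_mul ?summand_in//.
by rewrite summand_out// mul0mx.
Qed.

Lemma mul_summandr i x (m : 'M[C]_(d i)) :
  mma_mul x (summand m) = summand (x i *m m).
Proof.
apply: summand_ext => [|j ij]; rewrite /mma_mul ?summand_in//.
by rewrite summand_out// mulmx0.
Qed.

Lemma mul_summandl i x (m : 'M[C]_(d i)) :
  mma_mul (summand m) x = summand (m *m x i).
Proof.
apply: summand_ext => [|j ij]; rewrite /mma_mul ?summand_in//.
by rewrite summand_out// mul0mx.
Qed.

Lemma adj_summand i (m : 'M[C]_(d i)) :
  mma_adj (summand m) = summand (m^t*).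
Proof.
apply: summand_ext => [|j ij]; rewrite /mma_adj ?summand_in//.
by rewrite summand_out// trmx0 map_mx0.
Qed.

Lemma mma_trace_supported (t : I -> R) (s : seq I) x :
  uniq s -> supported s x ->
  mma_trace t x = \sum_(i <- s) (t i)%:C * \tr (x i).
Proof.
move=> us hs; rewrite /mma_trace (summability_sum_supp us)// => i /hs ->.
by rewrite linear0 mulr0.
Qed.

Lemma mma_trace_summand (t : I -> R) i (m : 'M[C]_(d i)) :
  mma_trace t (summand m) = (t i)%:C * \tr m.
Proof.
rewrite (mma_trace_supported t _ (supported_summand m))// big_seq1.
by rewrite summand_in.
Qed.

End OneFamily.
End BoundedFamilies.

(** * Inclusions of multi-matrix algebras and restriction of traces *)

(** The trace with weights [tJ] restricts to the one with weights [tI] along an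
    inclusion with matrix [M], whose rows are finitely supported:
    [tI] is the product of [M] and the vector [tJ]. *)
Definition restricts_to (R : realType) (I J : eqType) (M : I -> J -> nat)
    (tJ : J -> R) (tI : I -> R) : Prop :=
  forall i, exists s : seq J,
    [/\ uniq s, forall j, j \notin s -> M i j = 0%N &
        \sum_(j <- s) (M i j)%:R * tJ j = tI i].

Section Inclusion.
Variables (R : realType) (I J : countType) (dX : I -> nat) (dY : J -> nat).
Variables (M : I -> J -> nat) (f : Defs.family R dX -> Defs.family R dY).
Hypothesis fM : mma_inclusion M f.
Hypothesis dX_gt0 : forall i, (0 < dX i)%N.
Local Notation C := R[i].

Lemma incl_summandM i (m m' : 'M[C]_(dX i)) j :
  f (summand (m *m m')) j = f (summand m) j *m f (summand m') j.
Proof. by rewrite -mul_summand (incl_mul fM)//; exact: mma_summand. Qed.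

Lemma incl_summandD i (m m' : 'M[C]_(dX i)) j :
  f (summand (m + m')) j = f (summand m) j + f (summand m') j.
Proof. by rewrite -summandD (incl_add fM)//; exact: mma_summand. Qed.

Lemma incl_summandZ i (a : C) (m : 'M[C]_(dX i)) j :
  f (summand (a *: m)) j = a *: f (summand m) j.
Proof. by rewrite -summandZ (incl_scale fM)//; exact: mma_summand. Qed.

Lemma incl_summand_adj i (m : 'M[C]_(dX i)) j :
  f (summand (m^t*)) j = (f (summand m) j)^t*.
Proof. by rewrite -adj_summand (incl_adj fM)//; exact: mma_summand. Qed.

Lemma incl_summand0 i j : f (summand (0 : 'M[C]_(dX i))) j = 0.
Proof. by rewrite -(scale0r 0) incl_summandZ scale0r. Qed.

(** Both sides are tracial functionals of [m], and they agree on a minimal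
    projection, where the trace is the rank. *)
Lemma mxtrace_incl_summand i (m : 'M[C]_(dX i)) j :
  \tr (f (summand m) j) = (M i j)%:R * \tr m.
Proof.
pose k := Ordinal (dX_gt0 i).
have -> := @tracial_mxtrace _ _ (fun m => \tr (f (summand m) j)) k.
- have [qq _ _] := minimal_projection_delta R k.
  rewrite mxtrace_idempotent -?incl_summandM ?qq//.
  by rewrite (incl_multiplicity fM)//; exact: minimal_projection_delta.
- by move=> A B; rewrite incl_summandD linearD.
- by move=> a A; rewrite incl_summandZ linearZ.
- by move=> A B; rewrite !incl_summandM mxtrace_mulC.
Qed.

Lemma incl_summand_eq0 i (m : 'M[C]_(dX i)) j :
  M i j = 0%N -> f (summand m) j = 0.
Proof.
move=> M0; apply: mxtrace_adj_mul_eq0.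
by rewrite -incl_summand_adj -incl_summandM mxtrace_incl_summand M0 mul0r.
Qed.

Lemma incl_supported (s : seq I) x j : uniq s -> supported s x ->
  f x j = \sum_(i <- s) f (summand (x i)) j.
Proof.
move=> us hs; rewrite (incl_normal fM j (mma_supported hs)).
rewrite (fsbig_supp_seq us)// => i /hs ->; exact: incl_summand0.
Qed.

Lemma mxtrace_incl (s : seq I) x j : uniq s -> supported s x ->
  \tr (f x j) = \sum_(i <- s) (M i j)%:R * \tr (x i).
Proof.
move=> us hs; rewrite (incl_supported j us hs) linear_sum/=.
by apply: eq_bigr => i _; exact: mxtrace_incl_summand.
Qed.

(** The trace on the target, composed with the inclusion, is the trace on the
    source with the restricted weights. *)
Lemma mma_trace_incl (tJ : J -> R) (tI : I -> R) (s : seq I) x :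
  restricts_to M tJ tI -> uniq s -> supported s x ->
  exists s' : seq J, [/\ uniq s', supported s' (f x) &
    mma_trace tJ (f x) = mma_trace tI x].
Proof.
move=> hM us hs; have [row hrow] := choice hM.
pose s' := undup (flatten [seq row i | i <- s]).
have us' : uniq s' by exact: undup_uniq.
have row0 i j : i \in s -> j \notin s' -> M i j = 0%N.
  move=> si; rewrite mem_undup => js; have [_ -> //] := hrow i.
  by apply: contra js => ji; apply/flattenP; exists (row i) => //; exact: map_f.
have hs' : supported s' (f x).
  move=> j js; rewrite (incl_supported j us hs) big_seq big1// => i si.
  by rewrite incl_summand_eq0// row0.
exists s'; split=> //.
rewrite (mma_trace_supported _ us' hs') (mma_trace_supported _ us hs).
under eq_bigr do rewrite (mxtrace_incl _ us hs) mulr_sumr.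
rewrite exchange_big/=; apply: eq_big_seq => i si.
have [ui hi <-] := hrow i.
rewrite (@big_supp_eq _ _ (row i) s')//; first last.
- by move=> j js; rewrite row0// mul0r.
- by move=> j js; rewrite hi// mul0r.
rewrite rmorph_sum/= mulr_suml; apply: eq_bigr => j _.
by rewrite mulrCA mulrA rmorphM rmorph_nat.
Qed.

End Inclusion.

(** * The inequality for commuting squares *)

Section CommutingSquare.
Variables (R : realType) (IA IB IC ID : countType).
Variables (H : IA -> IB -> nat) (G1 : IA -> IC -> nat).
Variables (K : IC -> ID -> nat) (G2 : IB -> ID -> nat).
Variables (tA : IA -> R) (tB : IB -> R) (tC : IC -> R) (tD : ID -> R).

(** Here [H a b * G2 b d] is the rank in the summand [d] of [D] of the image of a
    minimal projection of the summand [a] of [A], for [d] in [ds]: all of it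
    factors through [b], and all of it factors through [c]. *)
Theorem commuting_square_inequality (a : IA) (b : IB) (c : IC) (ds : seq ID) :
    exists_commuting_square H G1 K G2 tD ->
    restricts_to G2 tD tB -> restricts_to K tD tC ->
    restricts_to H tB tA -> restricts_to G1 tC tA ->
    0 < tA a -> (forall d, 0 <= tD d) -> uniq ds ->
    (forall d b', d \in ds -> b' != b -> H a b' = 0%N \/ G2 b' d = 0%N) ->
    (forall d c', d \in ds -> c' != c -> G1 a c' = 0%N \/ K c' d = 0%N) ->
  (H a b)%:R * (\sum_(d <- ds) (G2 b d)%:R * tD d) * tA a <=
  ((H a b)%:R * tB b) * ((G1 a c)%:R * tC c).
Proof.
move=> [dA [dB [dC [dD [fAB [fAC [fCD [fBD [EA [EB [EC]]]]]]]]]]].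
move=> [[dA0 dB0 dC0 _] [iH iG1 iK iG2] [fE _] [hEA hEB hEC] hE].
move=> rG2 rK rH rG1 tA0 tD0 uds onlyb onlyc.
pose k := Ordinal (dA0 a); pose q0 : 'M[R[i]]_(dA a) := delta_mx k k.
pose q := summand q0; pose x := fAB q; pose z := fAC q; pose p := fBD x.
have mq : mma q by exact: mma_summand.
have mx : mma x by exact: incl_range iH _ mq.
have mz : mma z by exact: incl_range iG1 _ mq.
have pE : p = fCD z by exact: fE.
have qq : mma_mul q q = q by rewrite mul_summand mul_delta_mx.
have qadj : mma_adj q = q by rewrite adj_summand trmx_delta map_delta_mx.
have xx : mma_mul x x = x by rewrite -(incl_mul iH)// qq.
have zz : mma_mul z z = z by rewrite -(incl_mul iG1)// qq.
have xadj : mma_adj x = x by rewrite -(incl_adj iH)// qadj.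
have zadj : mma_adj z = z by rewrite -(incl_adj iG1)// qadj.
have xxb : x b *m x b = x b by rewrite -[in RHS]xx.
have zzc : z c *m z c = z c by rewrite -[in RHS]zz.
have xadjb : (x b)^t* = x b by rewrite -[in RHS]xadj.
have zadjc : (z c)^t* = z c by rewrite -[in RHS]zadj.
pose pb := fBD (summand (x b)); pose pc := fCD (summand (z c)).
have mpb : mma pb by apply: incl_range iG2 _ _; exact: mma_summand.
have mpc : mma pc by apply: incl_range iK _ _; exact: mma_summand.
have pbp : mma_mul pb p = pb.
  rewrite -(incl_mul iG2)//; last exact: mma_summand.
  by rewrite mul_summandl xxb.
have ppc : mma_mul p pc = pc.
  rewrite pE -(incl_mul iK)//; last exact: mma_summand.
  by rewrite mul_summandr zzc.
have pcp : mma_mul pc p = pc.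
  rewrite pE -(incl_mul iK)//; last exact: mma_summand.
  by rewrite mul_summandl zzc.
(* Supports and traces of the elements involved. *)
have [sx [usx hsx trx]] :=
  mma_trace_incl iH dA0 rH (isT : uniq [:: a]) (supported_summand q0).
have [sz [usz hsz trz]] :=
  mma_trace_incl iG1 dA0 rG1 (isT : uniq [:: a]) (supported_summand q0).
have [sp [usp hsp trp]] := mma_trace_incl iG2 dB0 rG2 usx hsx.
have [sb [usb hsb trb]] :=
  mma_trace_incl iG2 dB0 rG2 (isT : uniq [:: b]) (supported_summand (x b)).
have [sc [usc hsc trc]] :=
  mma_trace_incl iK dC0 rK (isT : uniq [:: c]) (supported_summand (z c)).
have q0tr : \tr q0 = 1.
  rewrite mxtrace_idempotent; last by rewrite mul_delta_mx.
  by rewrite mxrank_delta.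
have tau_p : mma_trace tD p = (tA a)%:C.
  by rewrite trp trx mma_trace_summand q0tr mulr1.
have tau_pb : mma_trace tD pb = (tB b * (H a b)%:R)%:C.
  rewrite trb mma_trace_summand (mxtrace_incl_summand iH)// q0tr mulr1.
  by rewrite rmorphM rmorph_nat.
have tau_pc : mma_trace tD pc = (tC c * (G1 a c)%:R)%:C.
  rewrite trc mma_trace_summand (mxtrace_incl_summand iG1)// q0tr mulr1.
  by rewrite rmorphM rmorph_nat.
have tau_scale (s : seq ID) (v : Defs.family R dD) e : uniq s -> supported s v ->
    mma_trace tD (mma_scale e v) = e * mma_trace tD v.
  move=> us hs; rewrite (mma_trace_supported _ us hs).
  rewrite (@mma_trace_supported _ _ _ _ s)//; last first.
    by move=> i /hs; rewrite /mma_scale => ->; rewrite scaler0.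
  by rewrite mulr_sumr; apply: eq_bigr => i _; rewrite linearZ/= mulrCA.
(* [EA pc] lies in the corner [p A p], which is one-dimensional. *)
have [e EApc] : exists e, EA pc = mma_scale e p.
  have [y my fy] := cond_exp_range hEA mpc.
  have Np : [set fBD (fAB w) | w in @mma R IA dA] p by exists q.
  have EApE : EA pc = mma_mul (mma_mul p (EA pc)) p.
    by rewrite -(cond_exp_bimodule hEA Np mpc Np) ppc pcp.
  have mqy : mma (mma_mul q y) by exact: mma_mul_closed.
  have mfy : mma (fAB y) by exact: incl_range iH _ my.
  have mxfy : mma (mma_mul x (fAB y)).
    by rewrite -(incl_mul iH mq my); exact: incl_range iH _ mqy.
  exists (y a k k); rewrite EApE -fy /p.
  rewrite -(incl_mul iG2 mx mfy) -(incl_mul iG2 mxfy mx).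
  rewrite -(incl_mul iH mq my) -(incl_mul iH mqy mq).
  rewrite /q mul_summandl mul_summand rank1_compression -summandZ.
  by rewrite (incl_scale iH _ mq) (incl_scale iG2 _ mx).
have EBpc : EB pc = mma_scale e p.
  have Npc : [set fCD w | w in @mma R IC dC] pc.
    by exists (summand (z c)) => //; exact: mma_summand.
  by rewrite -EApc (proj1 (hE _ mpc)) (cond_exp_id hEC Npc).
have tau_e : e * (tA a)%:C = (tC c * (G1 a c)%:R)%:C.
  rewrite -tau_pc -(cond_exp_trace hEA mpc) EApc -tau_p.
  by rewrite (tau_scale sp).
(* The trace of [pb pc] is that of [EB (pb pc) = pb (EB pc) = e pb]. *)
have mw : mma (mma_mul pb pc) by exact: mma_mul_closed.
have tau_w : mma_trace tD (mma_mul pb pc) = e * (tB b * (H a b)%:R)%:C.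
  rewrite -(cond_exp_trace hEB mw).
  have Npb : [set fBD w | w in @mma R IB dB] pb.
    by exists (summand (x b)) => //; exact: mma_summand.
  have mone (I : countType) (d : I -> nat) : mma (mma_one R d).
    by exists 1 => i v; rewrite mul1mx mul1r.
  have N1 : [set fBD w | w in @mma R IB dB] (mma_one R dD).
    by exists (mma_one R dB) => //; exact: incl_one iG2.
  have mul1 v : mma_mul v (mma_one R dD) = v.
    by apply: family_ext => i; rewrite /mma_mul /mma_one mulmx1.
  have := cond_exp_bimodule hEB Npb mpc N1; rewrite !mul1 EBpc => ->.
  have -> : mma_mul pb (mma_scale e p) = mma_scale e pb.
    by rewrite -{2}pbp; apply: family_ext => i; rewrite /mma_mul /mma_scale scalemxAr.
  by rewrite (tau_scale sb)// tau_pb.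
have hsw : supported (undup (sb ++ ds)) (mma_mul pb pc).
  move=> i; rewrite mem_undup mem_cat negb_or => /andP[/hsb h _].
  by rewrite /mma_mul [pb i]h mul0mx.
(* The components of [pb] and [pc] are projections, so those of [pb pc] have
   nonnegative trace; over [ds] both agree with [p]. *)
have proj_pb d : pb d *m pb d = pb d /\ (pb d)^t* = pb d.
  rewrite /pb -(incl_summandM iG2) -(incl_summand_adj iG2).
  by rewrite xxb xadjb.
have proj_pc d : pc d *m pc d = pc d /\ (pc d)^t* = pc d.
  rewrite /pc -(incl_summandM iK) -(incl_summand_adj iK).
  by rewrite zzc zadjc.
have w_ge0 d : 0 <= (tD d)%:C * \tr (mma_mul pb pc d).
  have [? ?] := proj_pb d; have [? ?] := proj_pc d.
  rewrite mulr_ge0 ?lecR ?tD0//; exact: mxtrace_mul_projections_ge0.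
have pb_ds d : d \in ds -> pb d = p d.
  move=> dds; rewrite /p (incl_supported iG2 d usx hsx).
  rewrite (@big_supp_eq _ _ sx [:: b])// ?big_seq1// => b'.
    by move=> /hsx ->; exact: incl_summand0 iG2 _ _.
  rewrite inE => /(onlyb _ _ dds)[Hab|Gbd]; last exact: incl_summand_eq0 iG2 _ _ _ _ _.
  by rewrite /x /q (incl_summand_eq0 iH)//; exact: incl_summand0 iG2 _ _.
have pc_ds d : d \in ds -> pc d = p d.
  move=> dds; rewrite pE (incl_supported iK d usz hsz).
  rewrite (@big_supp_eq _ _ sz [:: c])// ?big_seq1// => c'.
    by move=> /hsz ->; exact: incl_summand0 iK _ _.
  rewrite inE => /(onlyc _ _ dds)[Hac|Gcd]; last exact: incl_summand_eq0 iK _ _ _ _ _.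
  by rewrite /z /q (incl_summand_eq0 iG1)//; exact: incl_summand0 iK _ _.
have w_ds d : d \in ds -> \tr (mma_mul pb pc d) = ((G2 b d)%:R * (H a b)%:R).
  move=> dds; rewrite /mma_mul (pc_ds _ dds) -(pb_ds _ dds) (proj1 (proj_pb d)).
  by rewrite (mxtrace_incl_summand iG2)// (mxtrace_incl_summand iH)// q0tr mulr1.
(* Only the summands in [ds] are kept in the trace of [pb pc]. *)
have w_le : \sum_(d <- ds) (tD d)%:C * \tr (mma_mul pb pc d) <=
    e * (tB b * (H a b)%:R)%:C.
  rewrite -tau_w (mma_trace_supported _ (undup_uniq _) hsw).
  rewrite [leRHS](bigID [in ds])/=.
  have -> : \sum_(d <- ds) (tD d)%:C * \tr (mma_mul pb pc d) =
    \sum_(d <- undup (sb ++ ds) | d \in ds) (tD d)%:C * \tr (mma_mul pb pc d).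
    rewrite -[RHS]big_filter; apply: perm_big; apply: uniq_perm => //.
      by rewrite filter_uniq// undup_uniq.
    by move=> d; rewrite mem_filter mem_undup mem_cat; case: (d \in ds); rewrite ?orbT.
  by rewrite lerDl; apply: sumr_ge0.
have tAC : 0 <= (tA a)%:C by rewrite lecR ltW.
have := ler_wpM2r tAC w_le; rewrite mulrAC tau_e.
rewrite (_ : \sum_(d <- ds) _ =
   (((H a b)%:R * (\sum_(d <- ds) (G2 b d)%:R * tD d))%:C)%R); last first.
  rewrite rmorphM rmorph_sum mulr_sumr/=; apply: eq_big_seq => d dds.
  by rewrite w_ds// !rmorphM !rmorph_nat; ring.
rewrite -!rmorphM lecR => h; apply: le_trans h _.
by rewrite le_eqVlt; apply/orP; left; apply/eqP; ring.
Qed.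

End CommutingSquare.

(** * Powers and polynomials of row-finite matrices *)

Section RowFinite.
Variables (V : choiceType) (C : comNzRingType).
Implicit Types A B : V -> V -> C.

(** The rows of [A] are finitely supported, and [xi] is an eigenvector of [A]
    with eigenvalue [mu]. *)
Definition row_finite_eigen A (xi : V -> C) (mu : C) : Prop :=
  forall u, exists s : seq V,
    [/\ uniq s, forall v, v \notin s -> A u v = 0 &
        \sum_(v <- s) A u v * xi v = mu * xi u].

Lemma row_finite_eigen_one xi : row_finite_eigen (@inf_one V C) xi 1.
Proof.
move=> u; exists [:: u]; split=> // [v|].
  by rewrite inE /inf_one eq_sym => /negbTE ->.
by rewrite big_seq1 /inf_one eqxx.
Qed.

Lemma row_finite_eigen_mul A B xi mu nu : row_finite_eigen A xi mu ->
  row_finite_eigen B xi nu -> row_finite_eigen (inf_mul A B) xi (mu * nu).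
Proof.
move=> hA /choice[row hB] u; have [s [us s0 sE]] := hA u.
have mulE v : inf_mul A B u v = \sum_(w <- s) A u w * B w v.
  by rewrite /inf_mul (fsbig_supp_seq us)// => w /s0 ->; rewrite mul0r.
pose s' := undup (flatten [seq row w | w <- s]).
have s'0 w v : w \in s -> v \notin s' -> B w v = 0.
  move=> sw; rewrite mem_undup => vs; have [_ -> //] := hB w.
  by apply: contra vs => vw; apply/flattenP; exists (row w) => //; exact: map_f.
exists s'; split=> [|v vs|]; first exact: undup_uniq.
  by rewrite mulE big_seq big1// => w sw; rewrite (s'0 w)// mulr0.
under eq_bigr do rewrite mulE mulr_suml.
rewrite exchange_big/= mulrAC -sE mulr_suml; apply: eq_big_seq => w sw.
under eq_bigr do rewrite -mulrA.
rewrite -mulr_sumr -mulrA; congr (_ * _); have [uw w0 wE] := hB w.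
rewrite (@big_supp_eq _ _ s' (row w)) ?undup_uniq ?wE 1?mulrC//.
  by move=> v vs; rewrite (s'0 w)// mul0r.
by move=> v vs; rewrite w0// mul0r.
Qed.

Lemma row_finite_eigen_pow A xi mu k :
  row_finite_eigen A xi mu -> row_finite_eigen (inf_pow A k) xi (mu ^+ k).
Proof.
move=> hA; elim: k => [|k IHk]; first exact: row_finite_eigen_one.
by rewrite exprS; exact: row_finite_eigen_mul.
Qed.

Lemma row_finite_eigen_horner (p : {poly C}) A xi mu :
  row_finite_eigen A xi mu -> row_finite_eigen (inf_horner p A) xi p.[mu].
Proof.
move=> hA u.
have /choice[row hrow] k := row_finite_eigen_pow k hA u.
pose s := undup (flatten [seq row k | k <- iota 0 (size p)]).
have s0 k v : (k < size p)%N -> v \notin s -> inf_pow A k u v = 0.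
  move=> kp; rewrite mem_undup => vs; have [_ -> //] := hrow k.
  apply: contra vs => vk; apply/flattenP; exists (row k) => //.
  by apply: map_f; rewrite mem_iota.
exists s; split=> [|v vs|]; first exact: undup_uniq.
  by rewrite /inf_horner big1// => k _; rewrite s0// mulr0.
under eq_bigr do rewrite /inf_horner mulr_suml.
rewrite exchange_big/= horner_coef mulr_suml; apply: eq_bigr => k _.
under eq_bigr do rewrite -mulrA.
rewrite -mulr_sumr -mulrA; congr (_ * _); have [uk k0 <-] := hrow k.
apply: big_supp_eq => //; first exact: undup_uniq.
  by move=> v vs; rewrite s0// mul0r.
by move=> v vs; rewrite k0// mul0r.
Qed.

Lemma inf_powS_neq0 A k u v : inf_pow A k.+1 u v != 0 ->
  exists2 w, A u w != 0 & inf_pow A k w v != 0.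
Proof.
move=> /eqP h; apply: contrapT => /forall2NP hw; apply: h.
rewrite /inf_pow iterS -/(inf_pow A k) /inf_mul fsbig1// => w _.
have [/negP|/negP] := hw w; rewrite negbK => /eqP ->; first by rewrite mul0r.
by rewrite mulr0.
Qed.

Lemma inf_pow_lipschitz A (L : V -> nat) k u v :
  (forall u' v', A u' v' != 0 -> (L v' <= (L u').+1)%N) ->
  inf_pow A k u v != 0 -> (L v <= L u + k)%N.
Proof.
move=> hL; elim: k u => [|k IHk] u.
  rewrite /inf_pow /= /inf_one; have [->|_] := eqVneq u v; first by rewrite addn0.
  by rewrite eqxx.
case/inf_powS_neq0 => w /hL wu /IHk vw.
by apply: leq_trans vw _; rewrite addnS -addSn leq_add2r.
Qed.

Lemma inf_pow_parity A (col : V -> bool) k u v :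
  (forall u' v', A u' v' != 0 -> col v' = ~~ col u') ->
  inf_pow A k u v != 0 -> col v = col u (+) odd k.
Proof.
move=> hc; elim: k u => [|k IHk] u.
  rewrite /inf_pow /= /inf_one; have [->|_] := eqVneq u v; first by rewrite addbF.
  by rewrite eqxx.
case/inf_powS_neq0 => w /hc cw /IHk ->.
by rewrite cw /= addNb addbN.
Qed.

Lemma inf_horner_neq0 (p : {poly C}) A u v : inf_horner p A u v != 0 ->
  exists k : nat, [/\ (k < size p)%N, p`_k != 0 & inf_pow A k u v != 0].
Proof.
move=> /eqP h; apply: contrapT => hk; apply: h; rewrite /inf_horner big1// => k _.
have [->|pk0] := eqVneq p`_k 0; first by rewrite mul0r.
have [->|Ak0] := eqVneq (inf_pow A k u v) 0; first by rewrite mulr0.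
by case: hk; exists k.
Qed.

(** A step of the recursion for powers when all walks pass through [w]. *)
Lemma inf_powS_unique A k u v w :
  (forall w', A u w' != 0 -> inf_pow A k w' v != 0 -> w' = w) ->
  inf_pow A k.+1 u v = A u w * inf_pow A k w v.
Proof.
move=> hw; rewrite {1}/inf_pow iterS -/(inf_pow A k) /inf_mul.
rewrite (@fsbig_supp_seq _ _ [:: w])// ?big_seq1// => w'.
rewrite inE; apply: contra_neq_eq => h; apply: hw.
  by apply: contraNneq h => ->; rewrite mul0r.
by apply: contraNneq h => ->; rewrite mulr0.
Qed.

End RowFinite.

(** * The graph and the sequence r *)

Section GammaSequences.
Variables (R : realType) (lam x : R) (n : nat -> nat) (r a : nat -> R).
Hypothesis hgamma : gamma_sequences lam x n r a.
Hypothesis lam_gt0 : 0 < lam.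

(** The lower bound is the condition defining [n k], and the upper bound is the
    maximality of [n k]. *)
Lemma gamma_r_bounds k : (0 < k)%N ->
  expR (- x) <= r k.+1 < expR (- x) + lam^-1.
Proof.
move=> k0; have [h1 h2] := gamma_n hgamma k0.
rewrite (gamma_r hgamma k0) h1/= ltNge; apply/negP => h3.
have : (n k)%:Z + 1 <= (n k)%:Z.
  by apply: h2 => /=; rewrite intrD mulrDl opprD addrA mul1r lerBrDr.
by rewrite gerDl.
Qed.

Lemma gamma_r_gt0 k : (0 < k)%N -> 0 < r k.
Proof.
case: k => // -[_|k _]; first by rewrite (gamma_r1 hgamma).
by have /andP[h _] := gamma_r_bounds (ltn0Sn k); exact: lt_le_trans (expR_gt0 _) h.
Qed.

Lemma gamma_a_gt0 k : 0 < a k.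
Proof.
elim: k => [|k IHk]; first by rewrite (gamma_a0 hgamma).
by rewrite (gamma_a hgamma)// mulr_gt0// gamma_r_gt0.
Qed.

Lemma gamma_r_def k : r k.+1 = a k.+1 / a k.
Proof. by rewrite (gamma_a hgamma)//= mulfK// gt_eqF// gamma_a_gt0. Qed.

(** The eigenvector equation of the graph at [P_(k+1)]. *)
Lemma gamma_rec k : a k.+2 + (n k.+1)%:R * (a k.+1 / lam) + a k = lam * a k.+1.
Proof.
have r0 := gamma_r_gt0 (ltn0Sn k).
rewrite (gamma_a hgamma (ltn0Sn k.+1)) (gamma_r hgamma (ltn0Sn k))/=.
rewrite (gamma_a hgamma (ltn0Sn k))/=; field.
by rewrite !gt_eqF.
Qed.

Lemma gamma_a1 : a 1%N = lam.
Proof. by rewrite (gamma_a hgamma)// (gamma_r1 hgamma) (gamma_a0 hgamma) mulr1. Qed.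

End GammaSequences.

Section GammaGraph.
Variable n : nat -> nat.
Local Notation V := (gamma_vertex n).
Local Notation P i := (inl i : V).

Lemma gamma_adj_sym (u v : V) : gamma_adj u v = gamma_adj v u.
Proof. by case: u v => [i|p] [j|q] //=; rewrite orbC. Qed.

(** The list of the leaves attached to [P_k]. *)
Definition gamma_leaves (k : nat) : seq V :=
  [seq inr (existT (fun k => 'I_(n k)) k j) | j <- enum 'I_(n k)].

Lemma gamma_leavesP k (v : V) :
  reflect (exists2 q : {k : nat & 'I_(n k)}, v = inr q & tag q = k)
          (v \in gamma_leaves k).
Proof.
apply: (iffP mapP) => [[j _ ->]|[[k' j] -> /= k'k]].
  by exists (existT (fun k => 'I_(n k)) k j).
by subst k'; exists j => //; rewrite mem_enum.
Qed.

Lemma gamma_leaves_uniq k : uniq (gamma_leaves k).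
Proof.
rewrite map_inj_uniq ?enum_uniq// => j j' [].
exact: (@eq_from_Tagged nat (fun k => (ordinal (n k) : Type)) k).
Qed.

Lemma uniq_cons_leaves i k : uniq (P i :: gamma_leaves k).
Proof.
rewrite /= gamma_leaves_uniq andbT; apply/negP => /gamma_leavesP[q]; discriminate.
Qed.

Definition gamma_neighbors (u : V) : seq V :=
  match u with
  | inl 0 => P 1 :: gamma_leaves 0
  | inl k.+1 => P k :: P k.+2 :: gamma_leaves k.+1
  | inr q => [:: P (tag q)]
  end.

Lemma mem_gamma_neighbors (u v : V) : (v \in gamma_neighbors u) = gamma_adj u v.
Proof.
case: u => [[|k]|q]; case: v => [j|q'] //=; rewrite ?inE//=.
- rewrite (_ : (_ \in _) = false) ?orbF//.
  by apply/negP => /gamma_leavesP[q]; discriminate.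
- by apply/gamma_leavesP/eqP => [[q [->] //]|h]; exists q'.
- rewrite (_ : (_ \in _) = false) ?orbF//.
    have inlE (i l : nat) : (P i == P l) = (i == l) by [].
    by rewrite orbC !inlE eqSS [k == j]eq_sym.
  by apply/negP => /gamma_leavesP[q]; discriminate.
- by apply/gamma_leavesP/eqP => [[q [->] //]|h]; exists q'.
- by rewrite eq_sym.
Qed.

Lemma gamma_neighbors_uniq u : uniq (gamma_neighbors u).
Proof.
case: u => [[|k]|q] //; first exact: uniq_cons_leaves.
rewrite [gamma_neighbors _]/= cons_uniq uniq_cons_leaves andbT inE negb_or.
apply/andP; split; first by rewrite /eq_op/= neq_ltn ltnW.
by apply/negP => /gamma_leavesP[q]; discriminate.
Qed.

(** A labelling of the vertices along which edges change the label by one: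
    [P_j] has label [j + 1], so that there is room below it, and the leaves at
    [P_j] are placed below it for [j <= i] and above it otherwise.  Labels then
    bound distances from below, and the choice of [i] makes them detect that
    walks between leaves at [P_i] and leaves further up are longer than the walk
    between their attachment points. *)
Definition gamma_level (i : nat) (v : V) : nat :=
  match v with
  | inl j => j.+1
  | inr q => if (tag q <= i)%N then tag q else (tag q).+2
  end.

Lemma gamma_level_lipschitz i (u v : V) :
  gamma_adj u v -> (gamma_level i v <= (gamma_level i u).+1)%N.
Proof.
case: u v => [k|q] [l|q'] //=; last 2 [move=> /eqP ->].
- by case/orP => /eqP ->; lia.
- by case: ifP; lia.
- by case: ifP; lia.
Qed.

End GammaGraph.

(** * Polynomials in the adjacency matrix of the graph *)

(** If [xi] is an eigenvector of [M], and [M] relates colours that differ by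
    [flip], then the weights [xi] on one colour class restrict to multiples of
    [xi] on the other or the same class. *)
Lemma restricts_to_block (R : realType) (n : nat -> nat)
    (col : gamma_vertex n -> bool) (M : gamma_vertex n -> gamma_vertex n -> nat)
    (xi : gamma_vertex n -> R) (mu e : R) (b b' flip : bool) :
    restricts_to M xi (fun v => mu * xi v) ->
    (forall u v, M u v != 0%N -> col v = col u (+) flip) -> b' = b (+) flip ->
  restricts_to (block col M b b') (fun v : class col b' => e * xi (val v))
    (fun v : class col b => e * mu * xi (val v)).
Proof.
move=> hM hcol hb u; have [s [us s0 sE]] := hM (val u).
exists (pmap insub s); split=> [|v|].
- exact: pmap_sub_uniq.
- by rewrite mem_pmap_sub => /s0.
- rewrite -mulrA -sE mulr_sumr big_pmap /=.
  apply: eq_bigr => v _; case: insubP => [w cw <-|cv] /=.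
    by rewrite mulrCA.
  have [->|Muv] := eqVneq (M (val u) v) 0%N; first by rewrite mul0r mulr0.
  have /eqP cu : col (val u) == b := valP u.
  by rewrite (hcol _ _ Muv) cu hb eqxx in cv.
Qed.

Section GammaPolynomial.
Variables (R : realType) (lam x : R) (n : nat -> nat) (r a : nat -> R).
Hypothesis lam_gt0 : 0 < lam.
Hypothesis hgamma : gamma_sequences lam x n r a.
Local Notation V := (gamma_vertex n).
Local Notation C := R[i].
Local Notation P i := (inl i : V).
Local Notation xi := (gamma_weight lam a : V -> R).
Local Notation Delta := (fun u v : V => (gamma_matrix u v)%:R : C).

Lemma gamma_weight_gt0 v : 0 < xi v.
Proof.
have a0 := gamma_a_gt0 hgamma lam_gt0.
by case: v => [k|q] /=; rewrite ?divr_gt0.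
Qed.

Lemma sum_gamma_leaves k :
  \sum_(v <- gamma_leaves n k) xi v = (n k)%:R * (a k / lam).
Proof.
rewrite /gamma_leaves big_map /= big_const_seq count_predT size_enum_ord.
by rewrite iter_addr_0 mulr_natl.
Qed.

Lemma gamma_weight_eigen :
  restricts_to (@gamma_matrix n) xi (fun v => lam * xi v).
Proof.
move=> u; exists (gamma_neighbors u); split; first exact: gamma_neighbors_uniq.
  by move=> v; rewrite mem_gamma_neighbors /gamma_matrix => /negbTE ->.
transitivity (\sum_(v <- gamma_neighbors u) xi v).
  apply: eq_big_seq => v; rewrite mem_gamma_neighbors /gamma_matrix => ->.
  by rewrite mul1r.
case: u => [[|k]|q].
- rewrite big_cons sum_gamma_leaves (gamma_n0 hgamma) mul0r addr0 /=.
  by rewrite (gamma_a1 hgamma) (gamma_a0 hgamma) mulr1.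
- rewrite !big_cons sum_gamma_leaves /= -(gamma_rec hgamma lam_gt0) /=; ring.
- by rewrite big_seq1 /=; field; rewrite gt_eqF.
Qed.

Lemma Delta_neq0 u v : Delta u v != 0 -> gamma_adj u v.
Proof. by rewrite /gamma_matrix; case: gamma_adj; rewrite ?eqxx. Qed.

Variables (deg : nat) (p : {poly C}).
Hypothesis hp : size p = deg.+1.
Hypothesis hparity : (forall k : nat, p`_k != 0 -> ~~ odd k) \/
                     (forall k : nat, p`_k != 0 -> odd k).
Variable W : V -> V -> nat.
Hypothesis hW : forall u v, inf_horner p Delta u v = (W u v)%:R.

Let lead_neq0 : p`_deg != 0.
Proof. by have := lead_coef_eq0 p; rewrite lead_coefE hp -size_poly_eq0 hp => ->. Qed.

Lemma W_neq0 u v : W u v != 0%N -> exists k : nat,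
  [/\ (k <= deg)%N, p`_k != 0 & inf_pow Delta k u v != 0].
Proof.
move=> Wuv; have : inf_horner p Delta u v != 0 by rewrite hW pnatr_eq0.
by case/inf_horner_neq0 => k; rewrite hp ltnS; exists k.
Qed.

(** Walks change the level by at most their length. *)
Lemma inf_pow_level i k u v : inf_pow Delta k u v != 0 ->
  (gamma_level i v <= gamma_level i u + k)%N /\
  (gamma_level i u <= gamma_level i v + k)%N.
Proof.
move=> Duv; split.
  apply: inf_pow_lipschitz Duv => u' v' /Delta_neq0.
  exact: gamma_level_lipschitz.
pose L (z : V) := (gamma_level i u + gamma_level i v - gamma_level i z)%N.
have : (L v <= L u + k)%N.
  apply: inf_pow_lipschitz Duv => u' v' /Delta_neq0.
  by rewrite gamma_adj_sym => /(gamma_level_lipschitz i); rewrite /L; lia.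
by rewrite /L; lia.
Qed.

Lemma W_level i u v : W u v != 0%N ->
  (gamma_level i v <= gamma_level i u + deg)%N /\
  (gamma_level i u <= gamma_level i v + deg)%N.
Proof. by case/W_neq0 => k [kdeg _ /(inf_pow_level i)]; lia. Qed.

(** Walks of length [k] between [P_i] and [P_(i+k)] go straight. *)
Lemma inf_pow_up i k : inf_pow Delta k (P i) (P (i + k)%N) = 1.
Proof.
elim: k i => [|k IHk] i; first by rewrite addn0 /inf_pow /inf_one /= eqxx.
rewrite (@inf_powS_unique _ _ _ _ _ _ (P i.+1)).
  by rewrite addnS -addSn IHk mulr1 /gamma_matrix /= eqxx.
move=> w /Delta_neq0 iw /(inf_pow_level i)[].
case: w iw => [j /= /orP[]/eqP ->|q /= /eqP ->] //; first by lia.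
by rewrite leqnn; lia.
Qed.

Lemma inf_pow_down i k : inf_pow Delta k (P (i + k)%N) (P i) = 1.
Proof.
elim: k => [|k IHk]; first by rewrite addn0 /inf_pow /inf_one /= eqxx.
rewrite (@inf_powS_unique _ _ _ _ _ _ (P (i + k)%N)).
  by rewrite IHk mulr1 /gamma_matrix /= addnS eqxx orbT.
move=> w /Delta_neq0 wi /(inf_pow_level i)[_].
case: w wi => [j /= /orP[]/eqP h|q /= /eqP ->].
- by rewrite h; lia.
- by move: h; rewrite addnS => -[->].
- by case: ifP; lia.
Qed.

(** Such an entry of [p(Delta)] is the leading coefficient of [p]. *)
Lemma W_lead u v : inf_pow Delta deg u v = 1 ->
  (forall k, (k < deg)%N -> inf_pow Delta k u v = 0) -> W u v != 0%N.
Proof.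
move=> D1 D0; rewrite -(pnatr_eq0 C) -hW /inf_horner hp big_ord_recr /= D1 mulr1.
by rewrite big1 ?add0r// => k _; rewrite D0 ?mulr0.
Qed.

Lemma W_up i : W (P i) (P (i + deg)%N) != 0%N.
Proof.
apply: W_lead; first exact: inf_pow_up.
move=> k kdeg; apply/eqP; apply: contraTT kdeg => /(inf_pow_level i) /=; lia.
Qed.

Lemma W_down i : W (P (i + deg)%N) (P i) != 0%N.
Proof.
apply: W_lead; first exact: inf_pow_down.
move=> k kdeg; apply/eqP; apply: contraTT kdeg => /(inf_pow_level i) /=; lia.
Qed.

(** The Perron-Frobenius vector is an eigenvector of [p(Delta)], and the
    eigenvalue [p(lam)], a priori complex, is positive. *)
Lemma W_eigen : exists2 mu : R, 0 < mu & restricts_to W xi (fun v => mu * xi v).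
Proof.
have hD : row_finite_eigen Delta (fun v => (xi v)%:C) lam%:C.
  move=> u; have [s [us s0 sE]] := gamma_weight_eigen u.
  exists s; split=> // [v /s0 -> //|].
  rewrite -rmorphM -sE rmorph_sum; apply: eq_bigr => v _.
  by rewrite rmorphM rmorph_nat.
have hE := row_finite_eigen_horner p hD.
pose mu := complex.Re p.[lam%:C].
have hmu : restricts_to W xi (fun v => mu * xi v).
  move=> u; have [s [us s0 sE]] := hE u; exists s; split=> // [v /s0/eqP|].
    by rewrite hW pnatr_eq0 => /eqP.
  have ReM (z : C) (y : R) : complex.Re (z * y%:C) = complex.Re z * y.
    by case: z => z1 z2 /=; rewrite mulr0 subr0.
  rewrite -ReM -sE -[LHS]/(complex.Re (_%:C)) rmorph_sum; congr complex.Re.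
  by apply: eq_bigr => v _; rewrite rmorphM rmorph_nat hW.
exists mu => //; have [s [us s0 sE]] := hmu (P 0).
rewrite -(pmulr_lgt0 _ (gamma_weight_gt0 (P 0))) -sE.
have Wup := W_up 0; have Ps : P (0 + deg)%N \in s by apply: contraNT Wup => /s0 ->.
rewrite (big_rem _ Ps)/= ltr_pwDl//.
  by rewrite mulr_gt0 ?ltr0n ?lt0n// (gamma_weight_gt0 (P _)).
by apply: sumr_ge0 => v _; rewrite mulr_ge0 ?ler0n// ltW// gamma_weight_gt0.
Qed.

Variable col : V -> bool.
Hypothesis hcol : is_bipartition col.

Lemma adj_col u v : gamma_adj u v -> col v = ~~ col u.
Proof. by move=> /hcol; case: (col u); case: (col v). Qed.

Lemma W_col u v : W u v != 0%N -> col v = col u (+) odd deg.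
Proof.
case/W_neq0 => k [_ pk Duv].
have -> : odd deg = odd k.
  case: hparity => h; first by rewrite (negbTE (h _ pk)) (negbTE (h _ lead_neq0)).
  by rewrite (h _ pk) (h _ lead_neq0).
by apply: inf_pow_parity Duv => u' v' /Delta_neq0 /adj_col.
Qed.

Variable c : R.
Hypothesis hc : 0 < c.
Hypothesis hsquare :
     let G := block col (@gamma_matrix n) false true in
     let xi b := fun v : class col b => c * gamma_weight lam a (val v) in
     if odd deg then
       exists_commuting_square (block col W false true) G
         (block col W true false) (trmat G) (xi false)
     else
       exists_commuting_square (block col W false false) G
         (block col W true true) G (xi true).

(** Both parities of the degree at once: [A] and [C] carry the colours [false]
    and [true], and [B] and [D] those shifted by the parity of the degree. *)
Lemma gamma_square (e := odd deg) :
  exists_commuting_square (block col W false e)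
    (block col (@gamma_matrix n) false true) (block col W true (~~ e))
    (block col (@gamma_matrix n) e (~~ e))
    (fun v : class col (~~ e) => c * xi (val v)).
Proof.
move: hsquare => /=; rewrite -/e; case: e => //=.
suff -> : trmat (block col (@gamma_matrix n) false true) =
  block col (@gamma_matrix n) true false by [].
apply/funext => u; apply/funext => v.
by rewrite /trmat /block /gamma_matrix gamma_adj_sym.
Qed.

(** The inequality for commuting squares with the weights cancelled: [w] is the
    only vertex through which [p(Delta)] followed by an edge leads from [u] to a
    vertex of [ds], and [v] is the only one through which an edge followed by
    [p(Delta)] does. *)
Lemma gamma_inequality (u v w : V) (ds : seq V) :
    col u = false -> gamma_adj u v -> W u w != 0%N ->
    uniq ds -> {in ds, forall d, gamma_adj w d} ->
    (forall d w', d \in ds -> gamma_adj w' d -> W u w' != 0%N -> w' = w) ->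
    (forall d v', d \in ds -> gamma_adj u v' -> W v' d != 0%N -> v' = v) ->
  (\sum_(d <- ds) xi d) * xi u <= xi w * xi v.
Proof.
move=> cu uv Wuw uds wds onlyw onlyv.
have [mu mu0 hmu] := W_eigen.
have cw : col w == odd deg by rewrite (W_col Wuw) cu.
have cv : col v == true by rewrite (adj_col uv) cu.
have cds d : d \in ds -> col d == ~~ odd deg.
  by move=> /wds /adj_col ->; rewrite (eqP cw).
have cu' : col u == false by rewrite cu.
pose u1 : class col false := Sub u cu'.
pose v1 : class col true := Sub v cv.
pose w1 : class col (odd deg) := Sub w cw.
pose ds1 : seq (class col (~~ odd deg)) := pmap insub ds.
have DeltaC u' v' : gamma_matrix u' v' != 0%N -> col v' = col u' (+) true.
  by rewrite /gamma_matrix eqb0 negbK => /adj_col ->; rewrite addbT.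
pose t b e : class col b -> R := fun z => e * xi (val z).
have rG2 : restricts_to (block col (@gamma_matrix n) (odd deg) (~~ odd deg))
    (t _ c) (t _ (c * lam)).
  by apply: restricts_to_block gamma_weight_eigen DeltaC _; rewrite addbT.
have rK : restricts_to (block col W true (~~ odd deg)) (t _ c) (t _ (c * mu)).
  exact: restricts_to_block hmu W_col _.
have rH : restricts_to (block col W false (odd deg)) (t _ (c * lam))
    (t _ (c * lam * mu)).
  exact: restricts_to_block hmu W_col _.
have rG1 : restricts_to (block col (@gamma_matrix n) false true) (t _ (c * mu))
    (t _ (c * lam * mu)).
  by rewrite mulrAC; apply: restricts_to_block gamma_weight_eigen DeltaC _.
have tA0 : 0 < t _ (c * lam * mu) u1 by rewrite !mulr_gt0// gamma_weight_gt0.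
have tD0 d : 0 <= t (~~ odd deg) c d by rewrite mulr_ge0 ?ltW// gamma_weight_gt0.
have := commuting_square_inequality gamma_square rG2 rK rH rG1 tA0 tD0
  (pmap_sub_uniq _ uds : uniq ds1) (b := w1) (c := v1).
have onlyw1 (d : class col (~~ odd deg)) (w' : class col (odd deg)) :
    d \in ds1 -> w' != w1 -> block col W false (odd deg) u1 w' = 0%N \/
    block col (@gamma_matrix n) (odd deg) (~~ odd deg) w' d = 0%N.
  rewrite mem_pmap_sub => dds w'w.
  have [|Wuw'] := eqVneq (W u (val w')) 0%N; first by left.
  right; rewrite /block /gamma_matrix; case: (boolP (gamma_adj _ _)) => // adj.
  by move: w'w; rewrite -val_eqE /= (onlyw _ _ dds adj Wuw') eqxx.
have onlyv1 (d : class col (~~ odd deg)) (v' : class col true) :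
    d \in ds1 -> v' != v1 ->
    block col (@gamma_matrix n) false true u1 v' = 0%N \/
    block col W true (~~ odd deg) v' d = 0%N.
  rewrite mem_pmap_sub => dds v'v.
  have [|Wv'd] := eqVneq (W (val v') (val d)) 0%N; first by right.
  left; rewrite /block /gamma_matrix; case: (boolP (gamma_adj _ _)) => // adj.
  by move: v'v; rewrite -val_eqE /= (onlyv _ _ dds adj Wv'd) eqxx.
move=> /(_ onlyw1 onlyv1).
have -> : \sum_(d <- ds1)
    (block col (@gamma_matrix n) (odd deg) (~~ odd deg) w1 d)%:R * t _ c d =
    c * \sum_(d <- ds) xi d.
  rewrite big_pmap mulr_sumr; apply: eq_big_seq => d dds.
  rewrite insubT /=; first exact: cds.
  by move=> cd; rewrite /block /gamma_matrix /= wds// mul1r.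
have -> : block col (@gamma_matrix n) false true u1 v1 = 1%N.
  by rewrite /block /gamma_matrix /= uv.
rewrite /block /t /= mul1r.
have W0 : 0 < (W u w)%:R :> R by rewrite ltr0n lt0n.
set S := \sum_(d <- _) _ => h.
have k0 : 0 < (W u w)%:R * c * c * lam * mu by rewrite !mulr_gt0.
rewrite -(ler_pM2l k0); apply: le_trans (le_trans _ h) _;
  by rewrite le_eqVlt; apply/orP; left; apply/eqP; ring.
Qed.

(** The square from [P_i] up to the neighbours of [P_(i+deg)] other than
    [P_(i+deg-1)]. *)
Lemma gamma_ascending i : (0 < deg)%N -> col (P i) = false ->
  (a (i + deg).+1 + (n (i + deg))%:R * (a (i + deg) / lam)) * a i <=
  a (i + deg)%N * a i.+1.
Proof.
move=> deg0 ci.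
have := @gamma_inequality (P i) (P i.+1) (P (i + deg)%N)
  (P (i + deg).+1 :: gamma_leaves n (i + deg)).
rewrite big_cons sum_gamma_leaves /=; apply => //; rewrite ?eqxx//.
- exact: W_up.
- exact: uniq_cons_leaves.
- move=> d; rewrite inE => /orP[/eqP ->|/gamma_leavesP[q -> <-]] /=.
    by rewrite eqxx.
  by rewrite eqxx.
- move=> d w; rewrite inE => /orP[/eqP ->|/gamma_leavesP[q -> qi]]; last first.
    by rewrite gamma_adj_sym; case: w => [j|//] /=; rewrite qi => /eqP ->.
  rewrite gamma_adj_sym => adj /(W_level i)[].
  case: w adj => [j /= /orP[]/eqP h|q /= /eqP ->].
  + by rewrite h; lia.
  + by move: h => [<-].
  + by case: ifP; lia.
- move=> d v dds adj /(W_level i)[].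
  have -> : gamma_level i d = (i + deg).+2.
    move: dds; rewrite inE => /orP[/eqP -> //|/gamma_leavesP[q -> qi]] /=.
    by rewrite qi; case: ifP; lia.
  case: v adj => [j /= /orP[]/eqP ->|q /= /eqP ->] //; first by lia.
  by rewrite leqnn; lia.
Qed.

(** The square from [P_(i+deg+1)] down to the neighbours of [P_(i+1)] other than
    [P_(i+2)]. *)
Lemma gamma_descending i : (0 < deg)%N -> col (P (i + deg).+1) = false ->
  (a i + (n i.+1)%:R * (a i.+1 / lam)) * a (i + deg).+1 <=
  a i.+1 * a (i + deg)%N.
Proof.
move=> deg0 ci.
have := @gamma_inequality (P (i + deg).+1) (P (i + deg)%N) (P i.+1)
  (P i :: gamma_leaves n i.+1).
rewrite big_cons sum_gamma_leaves /=; apply => //; rewrite ?eqxx ?orbT//.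
- exact: (W_down i.+1).
- exact: uniq_cons_leaves.
- move=> d; rewrite inE => /orP[/eqP ->|/gamma_leavesP[q -> <-]] /=.
    by rewrite eqxx orbT.
  by rewrite eqxx.
- move=> d w; rewrite inE => /orP[/eqP ->|/gamma_leavesP[q -> qi]]; last first.
    by rewrite gamma_adj_sym; case: w => [j|//] /=; rewrite qi => /eqP ->.
  rewrite gamma_adj_sym => adj /(W_level i.+1)[_].
  case: w adj => [j /= /orP[]/eqP ->|q /= /eqP ->] //=; first by lia.
  by case: ifP; lia.
- move=> d v dds adj /(W_level i.+1)[_].
  have : (gamma_level i.+1 d <= i.+1)%N.
    move: dds; rewrite inE => /orP[/eqP -> //|/gamma_leavesP[q -> qi]] /=.
    by rewrite qi leqnn.
  case: v adj => [j /= /orP[]/eqP h|q /= /eqP ->] //=.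
  + by rewrite h; lia.
  + by move: h => [<-].
  + by case: ifP; lia.
Qed.

End GammaPolynomial.

(** * Eventual periodicity *)

Section Periodicity.
Variables (R : realType) (lam x : R) (n : nat -> nat) (r a : nat -> R).
Hypothesis lam_gt0 : 0 < lam.
Hypothesis hgamma : gamma_sequences lam x n r a.

Lemma gamma_n_def k : (0 < k)%N -> (n k)%:R = lam * (lam - (r k)^-1 - r k.+1).
Proof.
by move=> k0; rewrite (gamma_r hgamma k0); field; rewrite !gt_eqF// (gamma_r_gt0 hgamma).
Qed.

(** If [r (k + d) <= r k] for all large [k], then the sums of [d] consecutive
    values of [r] form a nonincreasing sequence, which converges; so
    [r k - r (k + d)] tends to 0, and so does the integer [n k - n (k + d)],
    since [n k] is a function of [r k] and [r (k + 1)]. *)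
Lemma eventually_periodic (d N : nat) :
  (forall k, (N <= k)%N -> r (k + d)%N <= r k) ->
  exists J : nat, forall i : nat, (J <= i)%N -> n i = n (i + d)%N.
Proof.
move=> rd; pose S k := \sum_(j < d) r (N.+2 + k + j)%N.
pose e := expR (- x); have e_gt0 : 0 < e by exact: expR_gt0.
have r_lb k : (2 <= k)%N -> e <= r k.
  by case: k => [|[|k]]// _; have /andP[] := gamma_r_bounds hgamma (ltn0Sn k).
have r_gt0 k : (0 < k)%N -> 0 < r k by exact: gamma_r_gt0 hgamma _ _.
have SE k : S k - S k.+1 = r (N.+2 + k)%N - r (N.+2 + k + d)%N.
  rewrite /S; case: (d) => [|d']; first by rewrite !big_ord0 addn0 !subrr.
  rewrite big_ord_recl big_ord_recr /= addn0.
  set A := \sum_(i < d') _; set B := \sum_(i < d') _.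
  have -> : A = B by apply: eq_bigr => j _; congr r; rewrite /bump; lia.
  rewrite (_ : (N.+2 + k.+1 + d')%N = (N.+2 + k + d'.+1)%N); last by lia.
  by ring.
have S_cvg : cvgn S.
  apply: nonincreasing_is_cvgn.
    by apply/nonincreasing_seqP => k; rewrite -subr_ge0 SE subr_ge0 rd//; lia.
  exists 0; move=> _ [k _ <-]; apply: sumr_ge0 => j _.
  by rewrite ltW// r_gt0.
have diff_cvg : (S k - S k.+1) @[k --> \oo] --> 0.
  rewrite -(subrr (limn S)); apply: cvgB => //.
  by rewrite (cvg_shiftS S).
pose eps := Num.min lam^-1 (e ^+ 2 / lam).
have eps_gt0 : 0 < eps by rewrite lt_min invr_gt0 lam_gt0 divr_gt0// exprn_gt0.
have /cvgr0Pnorm_lt/(_ _ eps_gt0)[K _ hK] := diff_cvg.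
pose del k := r k - r (k + d)%N.
have del_bounds k : (N.+2 + K <= k)%N -> 0 <= del k < eps.
  move=> hk; have kE : k = (N.+2 + (k - N.+2))%N by lia.
  rewrite /del subr_ge0 rd ?(leq_trans _ hk)//=; last by lia.
  have := hK (k - N.+2)%N; rewrite /= SE -kE => h.
  by apply: le_lt_trans (ler_norm _) (h _); lia.
exists (N.+2 + K)%N => i hi.
have i_gt0 : (0 < i)%N by lia.
have /andP[d1 d2] := del_bounds _ hi.
have /andP[d3 d4] := del_bounds i.+1 (leqW hi).
have diffE : (n i)%:R - (n (i + d)%N)%:R =
    lam * (del i / (r i * r (i + d)%N)) - lam * del i.+1.
  rewrite !gamma_n_def//; last by lia.
  by rewrite /del addSn; field; rewrite !gt_eqF// r_gt0//; lia.
have rr : e ^+ 2 <= r i * r (i + d)%N.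
  by rewrite expr2 ler_pM// ?r_lb ?ltW//; lia.
have rr0 : 0 < r i * r (i + d)%N by apply: lt_le_trans rr; rewrite exprn_gt0.
have q_lt1 : lam * (del i / (r i * r (i + d)%N)) < 1.
  rewrite mulrA ltr_pdivrMr// mul1r; apply: lt_le_trans rr.
  by rewrite mulrC -ltr_pdivlMr//; apply: lt_le_trans d2 _; rewrite ge_min lexx orbT.
have q_ge0 : 0 <= lam * (del i / (r i * r (i + d)%N)).
  by rewrite mulr_ge0 ?divr_ge0 ?(ltW lam_gt0) ?(ltW rr0).
have p_lt1 : lam * del i.+1 < 1.
  rewrite mulrC -ltr_pdivlMr// div1r.
  by apply: lt_le_trans d4 _; rewrite ge_min lexx.
have p_ge0 : 0 <= lam * del i.+1 by rewrite mulr_ge0// ltW.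
have lt1 : (n i)%:R < (n (i + d)%N)%:R + 1 :> R by lra.
have lt2 : (n (i + d)%N)%:R < (n i)%:R + 1 :> R by lra.
move: lt1 lt2; rewrite !natr1 !ltr_nat !ltnS => le1 le2.
by apply/eqP; rewrite eqn_leq le1 le2.
Qed.

End Periodicity.

Theorem mainTheorem15
  (R : realType) (lam x : R)
  (hlam : Num.sqrt (2 + Num.sqrt 5) < lam)
  (hx : 0 < x) (hlamx : lam = expR x + expR (- x))
  (n : nat -> nat) (r a : nat -> R)
  (hgamma : gamma_sequences lam x n r a)
  (col : gamma_vertex n -> bool) (hcol : is_bipartition col)
  (deg : nat) (hdeg : (1 <= deg)%N)
  (p : {poly R[i]}) (hp : size p = deg.+1)
  (hparity : (forall k : nat, p`_k != 0 -> ~~ odd k) \/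
             (forall k : nat, p`_k != 0 -> odd k))
  (W : gamma_vertex n -> gamma_vertex n -> nat)
  (hW : forall u v : gamma_vertex n,
     inf_horner p (fun u v => (gamma_matrix u v)%:R) u v = (W u v)%:R)
  (c : R) (hc : 0 < c)
  (hsquare :
     let G := block col (@gamma_matrix n) false true in
     let xi b := fun v : class col b => c * gamma_weight lam a (val v) in
     if odd deg then
       exists_commuting_square (block col W false true) G
         (block col W true false) (trmat G) (xi false)
     else
       exists_commuting_square (block col W false false) G
         (block col W true true) G (xi true)) :
  exists J : nat, forall i : nat, (J <= i)%N -> n i = n (i + deg)%N.
Proof.
have lam_gt0 : 0 < lam by rewrite hlamx addr_gt0 ?expR_gt0.
have r_gt0 := gamma_r_gt0 hgamma.
have a_gt0 := gamma_a_gt0 hgamma lam_gt0.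
pose cP k := col (inl k).
have cPS k : cP k.+1 = ~~ cP k by apply: (adj_col hcol) => /=; rewrite eqxx.
have cPD k m : cP (k + m)%N = cP k (+) odd m.
  elim: m => [|m IHm]; first by rewrite addn0 addbF.
  by rewrite addnS cPS IHm /= addbN.
(* The ascending square at [P_j] and the descending one at [P_(j+deg)] give the
   same inequality. *)
have step j : (0 < j)%N -> ~~ (cP j && cP (j + deg)%N) ->
    r (j + deg).+1 + (n (j + deg)%N)%:R / lam <= r j.+1.
  move=> j0; rewrite negb_and => /orP[/negbTE cj|/negbTE cj].
    have h := gamma_ascending lam_gt0 hgamma hp hparity hW hcol hc hsquare hdeg cj.
    rewrite (gamma_r_def hgamma lam_gt0) (gamma_r_def hgamma lam_gt0 j).
    rewrite ler_pdivlMr// -(ler_pM2r (a_gt0 (j + deg)%N)).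
    rewrite [leRHS]mulrC; apply: le_trans h; rewrite le_eqVlt; apply/orP; left.
    by apply/eqP; field; rewrite !gt_eqF.
  case: j j0 cj => // j _ cj.
  have h := gamma_descending lam_gt0 hgamma hp hparity hW hcol hc hsquare hdeg cj.
  have := gamma_rec hgamma lam_gt0 j.
  have := gamma_r_def hgamma lam_gt0 j.+1.
  have := gamma_rec hgamma lam_gt0 (j + deg).
  have := gamma_r_def hgamma lam_gt0 (j + deg).+1.
  rewrite !addSn => -> e1 -> e2.
  have -> : a (j + deg).+2 / a (j + deg).+1 + (n (j + deg).+1)%:R / lam =
      lam - a (j + deg)%N / a (j + deg).+1.
    apply: (mulIf (lt0r_neq0 (a_gt0 (j + deg).+1))).
    rewrite mulrBl -e1; field; rewrite !gt_eqF//.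
  have -> : a j.+2 = lam * a j.+1 - (a j + (n j.+1)%:R * (a j.+1 / lam)).
    by rewrite -e2; ring.
  rewrite mulrBl mulfK ?gt_eqF// lerD2l lerN2.
  by rewrite ler_pdivrMr// mulrAC ler_pdivlMr// [leRHS]mulrC.
have r_le j : (0 < j)%N -> ~~ (cP j && cP (j + deg)%N) ->
    r (j + deg).+1 <= r j.+1.
  move=> j0 cj; apply: le_trans (step j j0 cj).
  by rewrite lerDl divr_ge0 ?ler0n ?ltW.
have n_eq0 j : (0 < j)%N -> ~~ (cP j && cP (j + deg)%N) -> n (j + deg)%N = 0%N.
  move=> j0 cj; have := step j j0 cj.
  have /andP[lb _] := gamma_r_bounds hgamma (leq_trans j0 (leq_addr deg j)).
  have /andP[_ ub] := gamma_r_bounds hgamma j0 => h.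
  have : (n (j + deg)%N)%:R / lam < lam^-1 by lra.
  by rewrite ltr_pdivrMr// mulVf ?gt_eqF// ltrn1; lia.
apply: (@eventually_periodic _ _ _ _ _ _ lam_gt0 hgamma deg deg.+2) => k hk.
case: k hk => [//|k] hk; rewrite addSn.
have [ck|ck] := boolP (cP k && cP (k + deg)%N); last by apply: r_le; lia.
(* Here the degree is even and [P_(k+1)] has the colour [false]: the inequality
   holds one step further, where it determines the present one. *)
have odd_deg : odd deg = false.
  by move: ck; rewrite cPD; case: (cP k); case: (odd deg).
have ckS : cP k.+1 = false by rewrite cPS; case/andP: ck => ->.
have nocol m : cP m = false -> ~~ (cP m && cP (m + deg)%N) by move=> ->.
have := r_le k.+1 isT (nocol _ ckS).
have n0 : n k.+1 = 0%N.
  rewrite (_ : k.+1 = (k.+1 - deg) + deg)%N; last by lia.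
  apply: n_eq0; first by lia.
  apply: nocol; have := cPD (k.+1 - deg)%N deg.
  by rewrite odd_deg addbF subnK ?ckS//; lia.
have n0' : n (k + deg).+1 = 0%N by rewrite -addSn; apply: n_eq0 => //; exact: nocol.
rewrite addSn (gamma_r hgamma (ltn0Sn k)) (gamma_r hgamma (ltn0Sn (k + deg))).
rewrite n0 n0' mul0r !subr0 lerD2l lerN2.
by rewrite lef_pV2// posrE r_gt0.
Qed.
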